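(* Every finite extension of a Takahasi group is a Takahasi group; that is, if $G$ is a group having a subgroup $F$ of finite index which is a Takahasi group, then $G$ is a Takahasi group.
   Context: For a finitely generated group $H$, $\mathrm{rk}(H)=\min\{|X| : H=\langle X\rangle\}$. A group $G$ is a Takahasi group if every ascending chain $H_1\leq H_2\leq H_3\leq\cdots$ of finitely generated subgroups of $G$ with bounded rank (i.e. there is a constant $M$ with $\mathrm{rk}(H_j)\leq M$ for all $j$) is stationary. A group $G$ is a finite extension of $F$ if $F$ is a finite index subgroup of $G$ (not necessarily normal). *)

(* Defs.v *)
From mathcomp Require Import all_boot finmap.
From mathcomp Require Import all_classical.

Set Implicit Arguments.
Unset Strict Implicit.
Unset Printing Implicit Defensive.

Local Open Scope classical_set_scope.
Local Open Scope group_scope.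

(* Subgroups of a possibly infinite group [G] are classical sets over [G]. A   *)
(* property of a group [K] is stated for a subgroup [K : set G] of an ambient  *)
(* group, and for [G] itself by taking [K := [set: G]].                        *)

Definition subgroup (G : groupType) (H : set G) : Prop := group_closed [in H].

Definition generated (G : groupType) (X : set G) : set G :=
  smallest (@subgroup G) X.

Definition fin_gen (G : groupType) (H : set G) : Prop :=
  exists X : {fset G}, H = generated [set` X].

Definition gen_card (G : groupType) (H : set G) (n : nat) : Prop :=
  exists2 X : {fset G}, H = generated [set` X] & #|` X| = n.

(* The default value 0 is only used when [H] is not finitely generated.        *)
Definition rk (G : groupType) (H : set G) : nat :=
  if pselect (exists n, `[< gen_card H n >]) is left exH then ex_minn exH
  else 0.

Definition takahasi (G : groupType) (K : set G) : Prop :=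
  forall H : nat -> set G,
    (forall j, fin_gen (H j)) ->
    (forall j, H j `<=` K) ->
    (forall j, H j `<=` H j.+1) ->
    (exists M : nat, forall j, (rk (H j) <= M)%N) ->
    exists N : nat, forall j, (N <= j)%N -> H j = H N.

Definition left_coset (G : groupType) (F : set G) (x : G) : set G :=
  [set x * y | y in F].

Definition finite_index (G : groupType) (F : set G) : Prop :=
  finite_set (range (left_coset F)).

(* Main.v *)
Require Import Defs.
From mathcomp Require Import all_boot finmap.
From mathcomp Require Import all_classical.

(** Let H_0 <= H_1 <= ... be finitely generated subgroups of G of rank at most
    M. By a quantitative form of Schreier's lemma ([rk_setI]), each H_j `&` F
    is finitely generated, of rank bounded in terms of M and of the index of F
    alone. As F is a Takahasi group, the chain H_j `&` F is constant, equal to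
    some L, from some point on. On the other hand, the cosets of F that meet
    H_j form an increasing chain of subsets of the finite set G / F, so they
    too are constant from some point on ([chain_stationary]). Beyond both
    points, an h in H_j shares its coset h F with some h' of an earlier H_N
    that contains L, and then h'^-1 h lies in H_j `&` F = L <= H_N, so that h
    is in H_N: the chain H_j is stationary.

    The bound on the rank comes from the set of all products t'^-1 x t that
    lie in F, where t and t' range over representatives in H of the cosets
    that meet H, with 1 among them, and x is 1 or a generator of H. This set
    contains the classical Schreier generators, for which t' is the chosen
    representative of x t. Being larger, it requires neither that
    representatives be unique nor a function that chooses them, and it still
    has at most m (rk H + 1) m elements if there are m representatives. *)

Set Implicit Arguments.
Unset Strict Implicit.
Unset Printing Implicit Defensive.

Local Open Scope classical_set_scope.
Local Open Scope group_scope.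

(** * Subgroups, cosets and rank *)

Section Subgroup.
Variables (G : groupType) (H : set G).
Hypothesis sgH : subgroup H.

Lemma subgroup1 : H 1.
Proof. by have [/set_mem] := sgH. Qed.

Lemma subgroupV x : H x -> H x^-1.
Proof. by move=> /mem_set Hx; apply/set_mem; apply: (group_closedV sgH). Qed.

Lemma subgroupM x y : H x -> H y -> H (x * y).
Proof.
move=> /mem_set Hx /mem_set Hy; apply/set_mem.
exact: (group_closedM sgH).
Qed.

End Subgroup.

Lemma subgroupP (G : groupType) (H : set G) :
  H 1 -> (forall x y, H x -> H y -> H (x * y)) -> (forall x, H x -> H x^-1) ->
  subgroup H.
Proof.
move=> H1 HM HV; split; first exact: mem_set.
move=> x y /set_mem Hx /set_mem Hy; apply: mem_set; apply: HM => //; exact: HV.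
Qed.

Lemma subgroupI (G : groupType) (H K : set G) :
  subgroup H -> subgroup K -> subgroup (H `&` K).
Proof.
move=> sgH sgK; apply: subgroupP.
- by split; apply: subgroup1.
- by move=> x y [? ?] [? ?]; split; apply: subgroupM.
- by move=> x [? ?]; split; apply: subgroupV.
Qed.

Lemma subgroup_generated (G : groupType) (X : set G) : subgroup (generated X).
Proof.
apply: subgroupP.
- by move=> K [sgK _]; apply: subgroup1.
- move=> x y Hx Hy K KX; have [sgK _] := KX.
  by apply: subgroupM; [|apply: Hx|apply: Hy].
- by move=> x Hx K KX; have [sgK _] := KX; apply: subgroupV; [|apply: Hx].
Qed.

Lemma left_coset_inj (G : groupType) (F : set G) (x y : G) :
  subgroup F -> left_coset F x = left_coset F y -> F (x^-1 * y).
Proof.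
move=> sgF xFyF; have : left_coset F x y.
  by rewrite xFyF; exists 1; [exact: subgroup1|rewrite mulg1].
by case=> z Fz <-; rewrite mulKg.
Qed.

Lemma rk_gen_card (G : groupType) (H : set G) : fin_gen H -> gen_card H (rk H).
Proof.
move=> [X HX]; rewrite /rk; case: pselect => [exH|[]].
  by case: ex_minnP => n /asboolP.
by exists #|` X|; apply/asboolP; exists X.
Qed.

Lemma rk_leq (G : groupType) (H : set G) n : gen_card H n -> (rk H <= n)%N.
Proof.
move=> Hn; rewrite /rk; case: pselect => // exH.
by case: ex_minnP => m _; apply; apply/asboolP.
Qed.

(** * Schreier's lemma *)

(** The hypotheses say that x T and x^-1 T are contained in T Y for each
    generator x. Hence T S, where S is generated by Y, is stable under left
    multiplication by the whole group generated by X, and it contains 1. *)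
Lemma subgroup_covered (G : groupType) (X Y T : set G) :
  (forall x t, X x -> T t -> exists2 t', T t' & Y (t'^-1 * (x * t))) ->
  (forall x t, X x -> T t -> exists2 t', T t' & Y (t'^-1 * (x^-1 * t))) ->
  T 1 ->
  generated X `<=` [set t * s | t in T & s in generated Y].
Proof.
move=> XT XVT T1.
pose A : set G := [set t * s | t in T & s in generated Y].
have YT (x t s : G) : generated Y s ->
    (exists2 t', T t' & Y (t'^-1 * (x * t))) -> A (x * (t * s)).
  move=> Ys [t' Tt' Yt']; exists t' => //; exists (t'^-1 * (x * t) * s).
    by apply: (subgroupM (subgroup_generated Y)) => //; apply: sub_gen_smallest.
  by rewrite !mulgA mulgV mul1g.
(* Stability is required of h^-1 too so that N is a subgroup: an injection of
   an infinite set A into itself may fail to be onto. *)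
pose N : set G :=
  [set h | (forall a, A a -> A (h * a)) /\ (forall a, A a -> A (h^-1 * a))].
have sgN : subgroup N.
  apply: subgroupP.
  - by split=> a; rewrite ?invg1 mul1g.
  - move=> x y [xA xVA] [yA yVA]; split=> a Aa.
      by rewrite -mulgA; apply/xA/yA.
    by rewrite invgM -mulgA; apply/yVA/xVA.
  - by move=> x [xA xVA]; split=> a; rewrite ?invgK; [apply: xVA|apply: xA].
have XN : X `<=` N.
  move=> x Xx; split=> _ [t Tt [s Ys <-]]; apply: YT => //.
    exact: XT.
  exact: XVT.
move=> h Xh; rewrite -[h]mulg1.
have [hA _] : N h by apply: Xh.
apply: hA; exists 1 => //; exists 1; last by rewrite mulg1.
exact: (subgroup1 (subgroup_generated Y)).
Qed.

Lemma set_mem_fset_seq (T : choiceType) (s : seq T) :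
  [set` [fset x in s]%fset] = [set` s].
Proof. by apply/seteqP; split=> x /=; rewrite inE. Qed.

Lemma fin_gen_seq (G : groupType) (s : seq G) : fin_gen (generated [set` s]).
Proof. by exists [fset x in s]%fset; rewrite set_mem_fset_seq. Qed.

Lemma rk_generated_seq (G : groupType) (s : seq G) :
  (rk (generated [set` s]) <= size s)%N.
Proof.
rewrite (leq_trans _ (size_undup s)) // -card_fseq.
by apply: rk_leq; exists [fset x in s]%fset; rewrite ?set_mem_fset_seq.
Qed.

Section Schreier.
Variables (G : groupType) (F : set G) (X T : seq G).

(** The element 1 is added to [X] so that the members of [T] that lie in [F]
    are themselves in this sequence, as 1^-1 * (1 * t). *)
Definition schreier_seq : seq G :=
  [seq y <- [seq t'^-1 * z | t' <- T, z <- [seq x * t | x <- 1 :: X, t <- T]] |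
     y \in F].

Lemma size_schreier_seq :
  (size schreier_seq <= size T * ((size X).+1 * size T))%N.
Proof. by rewrite size_filter (leq_trans (count_size _ _)) ?size_allpairs. Qed.

Lemma schreier_seqP y :
  y \in schreier_seq <->
  F y /\ exists t' x t,
    [/\ t' \in T, x \in 1 :: X, t \in T & y = t'^-1 * (x * t)].
Proof.
rewrite mem_filter; split.
  move=> /andP[/set_mem Fy /allpairsP[[t' z] [Tt' /allpairsP[[x t] []]]]].
  by move=> Xx Tt /= -> yE; split=> //; exists t', x, t.
move=> [Fy [t' [x [t [Tt' Xx Tt yE]]]]].
apply/andP; split; first exact: mem_set.
apply/allpairsP; exists (t', x * t); split=> //.
by apply/allpairsP; exists (x, t).
Qed.

(** Write h in H `&` F as t s, with t in T and s in the group S generated by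
    [schreier_seq]. As S is contained in F, so is t, which is then itself in
    [schreier_seq]. *)
Lemma generated_schreier_seq :
  subgroup F -> 1 \in T -> [set` T] `<=` generated [set` X] ->
  (forall h, generated [set` X] h -> exists2 t, t \in T & F (t^-1 * h)) ->
  generated [set` X] `&` F = generated [set` schreier_seq].
Proof.
move=> sgF T1 TX rep; set H := generated _; set S := generated _.
have sgH : subgroup H by apply: subgroup_generated.
have sgS : subgroup S by apply: subgroup_generated.
have HX x : x \in X -> H x by move=> Xx; apply: sub_gen_smallest.
have HT t : t \in T -> H t by apply: TX.
have SF : S `<=` F.
  by apply: smallest_sub => // y /schreier_seqP[].
have inS t' x t : t' \in T -> x \in 1 :: X -> t \in T ->
    F (t'^-1 * (x * t)) -> S (t'^-1 * (x * t)).
  move=> *; apply: sub_gen_smallest; apply/schreier_seqP.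
  by split=> //; exists t', x, t.
apply/seteqP; split=> [h [Hh Fh]|]; last first.
  apply: smallest_sub; first exact: subgroupI.
  move=> y /schreier_seqP[Fy [t' [x [t [Tt' Xx Tt yE]]]]].
  split=> //; rewrite yE.
  apply: (subgroupM sgH); first by apply: (subgroupV sgH); apply: HT.
  apply: (subgroupM sgH); last exact: HT.
  by move: Xx; rewrite inE => /predU1P[->|/HX//]; apply: (subgroup1 sgH).
have HTS : H `<=` [set t * s | t in [set` T] & s in S].
  have -> : S = generated S by rewrite /generated smallest_id.
  apply: subgroup_covered => //= x t Xx Tt.
    have [|t' Tt' Ft'] := rep (x * t).
      by apply: (subgroupM sgH); [apply: HX|apply: HT].
    by exists t' => //; apply: inS => //; rewrite inE Xx orbT.
  have [|t' Tt' Ft'] := rep (x^-1 * t).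
    by apply: (subgroupM sgH); [apply: (subgroupV sgH); apply: HX|apply: HT].
  exists t' => //.
  (* The inverse of this element is again of the form t'^-1 x t, with the
     roles of t and t' exchanged. *)
  have E : t'^-1 * (x^-1 * t) = (t^-1 * (x * t'))^-1.
    by rewrite !invgM invgK !mulgA.
  rewrite E; apply: (subgroupV sgS); apply: inS => //.
    by rewrite inE Xx orbT.
  by rewrite -[_ * _]invgK -E; apply: subgroupV.
have [t Tt [s Ss tsE]] := HTS _ Hh.
have Ft : F t.
  have -> : t = h * s^-1 by rewrite -tsE mulgK.
  by apply: (subgroupM sgF) => //; apply: (subgroupV sgF); apply: SF.
have tE : t = 1^-1 * (1 * t) by rewrite invg1 !mul1g.
rewrite -tsE; apply: (subgroupM sgS) => //.
by rewrite tE; apply: inS; rewrite ?mem_head // -tE.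
Qed.

End Schreier.

(** The number m is uniform in H: one representative is chosen in H for each
    coset of F that meets H. Those that do not meet H contribute 1, and 1 is
    added once more in case another element represents F itself. *)
Lemma coset_representatives (G : groupType) (F : set G) :
  subgroup F -> finite_index F ->
  exists m, forall H : set G, subgroup H ->
    exists T : seq G, [/\ (size T <= m)%N, 1 \in T, [set` T] `<=` H &
      forall h, H h -> exists2 t, t \in T & F (t^-1 * h)].
Proof.
move=> sgF finF; pose cosets := fset_set (range (left_coset F)).
exists (size cosets).+1 => H sgH.
pose rep (C : set G) : G := xget 1 (H `&` C).
have repH C : H (rep C).
  by rewrite /rep; case: xgetP => [y _ []//|_]; apply: subgroup1.
exists (1 :: [seq rep C | C <- cosets]).
split=> [||g /=|h Hh].
- by rewrite /= size_map.
- exact: mem_head.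
- by rewrite inE => /predU1P[->|/mapP[C _ ->]//]; apply: subgroup1.
exists (rep (left_coset F h)).
  rewrite inE; apply/orP; right; apply: map_f.
  by rewrite in_fset_set // mem_set //; exists h.
have [_ [y Fy <-]] : (H `&` left_coset F h) (rep (left_coset F h)).
  apply: xgetPex; exists h; split=> //.
  by exists 1; rewrite ?mulg1 //; apply: subgroup1.
by rewrite invgM mulgVK; apply: subgroupV.
Qed.

(** What matters for chains is that the bound on the rank of the intersection
    depends on [H] only through its rank. *)
Lemma rk_setI (G : groupType) (F : set G) :
  subgroup F -> finite_index F ->
  exists m, forall H : set G, fin_gen H ->
    fin_gen (H `&` F) /\ (rk (H `&` F) <= m * ((rk H).+1 * m))%N.
Proof.
move=> sgF finF; have [m mP] := coset_representatives sgF finF.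
exists m => H fgH; have [X HX Xrk] := rk_gen_card fgH.
have sgH : subgroup H by rewrite HX; apply: subgroup_generated.
have [T [Tm T1 TH rep]] := mP H sgH.
have -> : H `&` F = generated [set` schreier_seq F X T].
  by rewrite -generated_schreier_seq -?HX.
split; first exact: fin_gen_seq.
apply: leq_trans (rk_generated_seq _) _.
apply: leq_trans (size_schreier_seq _ _ _) _.
by rewrite Xrk !leq_mul.
Qed.

(** * Chains of subsets of a finite set *)

(** Each of the finitely many points of the union appears at some stage, and N
    is the largest of these stages. *)
Lemma chain_stationary (U : choiceType) (Q : nat -> set U) :
  (forall i j, (i <= j)%N -> Q i `<=` Q j) -> finite_set (\bigcup_j Q j) ->
  exists N, forall j, Q j `<=` Q N.
Proof.
move=> Qle finQ; pose D := fset_set (\bigcup_j Q j).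
pose stage x := xget 0%N [set i | Q i x].
exists (\max_(x <- D) stage x)%N => j x Qx.
have Qi : Q (stage x) x.
  by apply: (@xgetPex _ _ [set i | Q i x]); exists j.
apply: Qle Qi; apply: leq_bigmax_seq => //.
by rewrite in_fset_set // mem_set //; exists j.
Qed.

(** * Finite extensions of Takahasi groups *)

Theorem theorem4p1 (G : groupType) (F : set G) :
  subgroup F -> finite_index F -> takahasi F -> takahasi [set: G]%classic.
Proof.
move=> sgF finF takF H fgH _ Hinc [M rkM].
have Hle i j : (i <= j)%N -> H i `<=` H j.
  elim: j => [|j IH]; first by rewrite leqn0 => /eqP->.
  rewrite leq_eqVlt => /predU1P[->//|/IH Hij].
  exact: subset_trans Hij (Hinc j).
have sgH j : subgroup (H j).
  by have [X ->] := fgH j; apply: subgroup_generated.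
have [m mP] := rk_setI sgF finF.
have [||||N NP] := takF (fun j => H j `&` F).
- by move=> j; have [] := mP _ (fgH j).
- by move=> j x [].
- by move=> j; apply: setSI.
- exists (m * (M.+1 * m))%N => j; have [_ /leq_trans->//] := mP _ (fgH j).
  by rewrite !leq_mul ?ltnS.
have [||N' N'P] :=
    @chain_stationary _ (fun j => [set left_coset F h | h in H j]).
- by move=> i j ij; apply: image_subset; apply: Hle.
- by apply: sub_finite_set finF => _ [j _ [h _ <-]]; exists h.
(* N stabilizes the intersections with F, N' the cosets that are met. *)
exists (maxn N N') => j le_j; apply/seteqP; split; last exact: Hle.
have le_N : (N <= maxn N N')%N by apply: leq_maxl.
move=> h Hjh.
have [h' Hh' /(left_coset_inj sgF) Fh] :
    [set left_coset F h | h in H N'] (left_coset F h).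
  by apply: (N'P j); exists h.
have Hh'max : H (maxn N N') h' by apply: Hle Hh'; apply: leq_maxr.
have [HNh _] : (H N `&` F) (h'^-1 * h).
  rewrite -(NP j); last exact: leq_trans le_j.
  split=> //; apply: subgroupM => //; apply: subgroupV => //.
  exact: Hle Hh'max.
rewrite -[h](mulVKg h'); apply: subgroupM => //; exact: Hle HNh.
Qed.
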